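(* Let $\mathbf{V}$ be a variety of groups which is finitely based and has finite gauge. Then the integral of $\mathbf{V}$ is finitely based.
   Context: A variety of groups is the class of all groups satisfying a given set of identities $w=1$ ($w$ a word in a free group); it is finitely based if it can be defined by a finite set of identities. The integral of a variety $\mathbf{V}$ is the class of all groups $H$ whose derived group (commutator subgroup) $H'$ belongs to $\mathbf{V}$; this class is a variety, equal to the product variety $\mathbf{V}\mathbf{A}$ of all groups with a normal subgroup in $\mathbf{V}$ and abelian quotient. A subset $S$ of a group $G$ is symmetric if $S=S^{-1}$. For a symmetric subset $S$ and $k\ge 0$ let $B_k(S)=\bigcup_{i=0}^k S^i$, where $S^i$ is the set of products of $i$ elements of $S$ and $S^0=\{1\}$. An identity $w(x_1,\dots,x_r)=1$ holds in $B_k(S)$ if $w(g_1,\dots,g_r)=1$ for all $g_1,\dots,g_r\in B_k(S)$. The gauge of a variety $\mathbf{V}$ is the smallest $k$ such that, whenever $G$ is a group with symmetric generating set $S$ and the identities $w=1$ defining $\mathbf{V}$ all hold in $B_k(S)$, then $G\in\mathbf{V}$ (the gauge is infinite if no such $k$ exists). For a finitely based variety, the ''identities defining $\mathbf{V}$'' are taken to be a finite set of defining identities; whether the gauge is finite does not depend on the choice of this finite set. *)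

(* Defs.v *)
From HB Require Import structures.
From mathcomp Require Export all_boot.
From mathcomp Require Export monoid boolp classical_sets.

Set Implicit Arguments.
Unset Strict Implicit.
Unset Printing Implicit Defensive.

Local Open Scope classical_set_scope.
Local Open Scope group_scope.

(* A groupType carries a choice structure; classically every type has one
   (boolp.gen_choiceMixin), so groupType covers all groups. *)

(* A word in the free group on x_0, x_1, ...: the letter (i, false) is x_i and
   (i, true) is x_i^-1. Words need not be reduced; every element of the free
   group is represented, and evaluation only depends on the element. *)
Definition word := seq (nat * bool).

Definition eval_word (G : groupType) (g : nat -> G) (w : word) : G :=
  \prod_(l <- w) (if l.2 then (g l.1)^-1 else g l.1).

(* The value of w only involves the g i with x_i occurring in w, so letting g
   range over infinite sequences is harmless for nonempty A. *)
Definition holds_in (G : groupType) (A : set G) (w : word) : Prop :=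
  forall g : nat -> G, (forall i, A (g i)) -> eval_word g w = 1.

Definition identity_of (G : groupType) (w : word) : Prop :=
  holds_in [set: G] w.

Definition defines (W : set word) (V : groupType -> Prop) : Prop :=
  forall G : groupType, V G <-> (forall w, W w -> identity_of G w).

Definition variety (V : groupType -> Prop) : Prop :=
  exists W : set word, defines W V.

Definition finitely_based (V : groupType -> Prop) : Prop :=
  exists W : seq word, defines [set` W] V.

Definition subgroup (G : groupType) (H : set G) : Prop :=
  group_closed (mem H).

Definition generated (G : groupType) (A : set G) : set G :=
  smallest (@subgroup G) A.

Definition commutators (G : groupType) : set G :=
  [set c | exists x y : G, c = [~ x, y]].
Arguments commutators : clear implicits.

Definition derived (G : groupType) : set G :=
  generated (commutators G).
Arguments derived : clear implicits.

Lemma generated_subgroup (G : groupType) (A : set G) : subgroup (generated A).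
Proof.
split; first by apply/mem_set => H [[H1 _] _]; exact: set_mem H1.
move=> x y /set_mem xA /set_mem yA; apply/mem_set => H HA.
case: (HA) => -[_ HD] _; apply: set_mem; apply: HD.
  exact: mem_set (xA H HA).
exact: mem_set (yA H HA).
Qed.

Definition derived_group (G : groupType) : Type := derived G.

HB.instance Definition _ (G : groupType) :=
  SubChoice.copy (derived_group G) {x : G | x \in derived G}.
HB.instance Definition _ (G : groupType) :=
  SubChoice_isSubGroup.Build G (fun x => x \in derived G) (derived_group G)
    (generated_subgroup (commutators G)).

Definition integral (V : groupType -> Prop) : groupType -> Prop :=
  fun H => V (derived_group H).

Definition symmetric_set (G : groupType) (S : set G) : Prop :=
  S = [set x^-1 | x in S].

Definition set_power (G : groupType) (S : set G) (i : nat) : set G :=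
  [set x | exists2 s : 'I_i -> G, (forall j, S (s j)) & x = \prod_(j < i) s j].

Definition ball (G : groupType) (S : set G) (k : nat) : set G :=
  \bigcup_(i in [set i | (i <= k)%N]) set_power S i.

Definition gauge_bound (V : groupType -> Prop) (W : set word) (k : nat) : Prop :=
  forall (G : groupType) (S : set G),
    symmetric_set S -> generated S = [set: G] ->
    (forall w, W w -> holds_in (ball S k) w) ->
    V G.

Definition is_gauge (V : groupType -> Prop) (W : set word) (k : nat) : Prop :=
  gauge_bound V W k /\ (forall j, gauge_bound V W j -> (k <= j)%N).

(* The gauge is taken with respect to a finite set of defining identities;
   whether it is finite does not depend on which one. *)
Definition finite_gauge (V : groupType -> Prop) : Prop :=
  exists W : seq word,
    defines [set` W] V /\ exists k, is_gauge V [set` W] k.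

(* Main.v *)
Require Import Defs.

(** Choose a finite basis [W] of [V] and a [k] such that a group lies in [V] as
    soon as [W] holds in the ball of radius [k] around 1, for some symmetric
    generating set. The derived group [H'] of [H] has a distinguished symmetric
    generating set: the commutators of [H]. As 1 is itself a commutator, the
    ball of radius [k] is the set of products of exactly [k] commutators, that
    is, the set of values in [H] of the single word
    [[x_1, y_1] ... [x_k, y_k]]. Hence [w] holds in this ball if and only if
    [H] satisfies the one identity obtained from [w] by substituting such a
    product, in fresh variables, for each variable of [w]
    ([identity_of_expansion]). If these finitely many identities hold in [H],
    then the gauge condition gives [H' \in V]; conversely, if [H' \in V], then
    [w] holds in all of [H'], in particular in the ball. *)

Set Implicit Arguments.
Unset Strict Implicit.
Unset Printing Implicit Defensive.

Local Open Scope classical_set_scope.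
Local Open Scope group_scope.

Definition inv_word (w : word) : word := rev [seq (l.1, ~~ l.2) | l <- w].

Definition subst_word (f : nat -> word) (w : word) : word :=
  flatten [seq if l.2 then inv_word (f l.1) else f l.1 | l <- w].

Section Evaluation.
Variables (G : groupType) (g : nat -> G).

Lemma eval_word_nil : eval_word g [::] = 1.
Proof. exact: big_nil. Qed.

Lemma eval_word_cons l w :
  eval_word g (l :: w) = (if l.2 then (g l.1)^-1 else g l.1) * eval_word g w.
Proof. exact: big_cons. Qed.

Lemma eval_word_cat w1 w2 :
  eval_word g (w1 ++ w2) = eval_word g w1 * eval_word g w2.
Proof. exact: big_cat. Qed.

Lemma eval_word_inv w : eval_word g (inv_word w) = (eval_word g w)^-1.
Proof.
elim: w => [|[i b] w IHw]; first by rewrite eval_word_nil invg1.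
rewrite /inv_word /= rev_cons -cats1 eval_word_cat [eval_word g (rev _)]IHw.
rewrite !eval_word_cons eval_word_nil mulg1 invgM /=.
by case: b; rewrite ?invgK.
Qed.

Lemma eval_word_flatten ws :
  eval_word g (flatten ws) = \prod_(w <- ws) eval_word g w.
Proof.
elim: ws => [|w ws IHws]; first by rewrite big_nil eval_word_nil.
by rewrite big_cons /= eval_word_cat IHws.
Qed.

Lemma eval_subst_word f w :
  eval_word g (subst_word f w) = eval_word (fun i => eval_word g (f i)) w.
Proof.
rewrite eval_word_flatten big_map; apply: eq_bigr => -[i []] _ //=.
exact: eval_word_inv.
Qed.

End Evaluation.

Definition commutator_word (i j : nat) : word :=
  [:: (i, true); (j, true); (i, false); (j, false)].

Lemma eval_commutator_word (G : groupType) (g : nat -> G) i j :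
  eval_word g (commutator_word i j) = [~ g i, g j].
Proof.
by rewrite !eval_word_cons eval_word_nil mulg1 /commg /conjg.
Qed.

(** Pickling the triples (i, j, b) makes the variables that occur in the
    products for different [i] pairwise distinct. *)
Definition commutators_word (k i : nat) : word :=
  flatten [seq commutator_word (pickle (i, j, false)) (pickle (i, j, true))
          | j <- iota 0 k].

Lemma eval_commutators_word (G : groupType) (g : nat -> G) k i :
  eval_word g (commutators_word k i) =
  \prod_(0 <= j < k) [~ g (pickle (i, j, false)), g (pickle (i, j, true))].
Proof.
rewrite eval_word_flatten big_map /index_iota subn0.
by apply: eq_bigr => j _; rewrite eval_commutator_word.
Qed.

Definition commutator_products (G : groupType) (k : nat) : set G :=
  [set x | exists c : nat -> G * G,
     x = \prod_(0 <= j < k) [~ (c j).1, (c j).2]].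
Arguments commutator_products : clear implicits.

(** As the variables are fresh, a valuation in [G] realises any prescribed
    sequence of products of [k] commutators, and conversely every valuation
    yields such a sequence. *)
Lemma identity_of_expansion (G : groupType) k w :
  identity_of G (subst_word (commutators_word k) w) <->
  holds_in (commutator_products G k) w.
Proof.
split=> [Gw g gP | kw g _].
  have /choice[c cP] := gP.
  (* The default value 1 is only taken at naturals that code no triple. *)
  pose h n := if unpickle n is Some (i, j, b) then
                if b then (c i j).2 else (c i j).1 else 1.
  rewrite -(Gw h) // eval_subst_word; congr eval_word; apply/funext => i.
  rewrite eval_commutators_word cP; apply: eq_bigr => j _.
  by rewrite /h !pickleK.
rewrite eval_subst_word; apply: kw => i.
exists (fun j => (g (pickle (i, j, false)), g (pickle (i, j, true)))).
exact: eval_commutators_word.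
Qed.

(** Padding with the trivial commutator [[1, 1]] makes the number of factors
    exactly [k]. *)
Lemma short_commutator_product (G : groupType) (k i : nat)
    (s : 'I_i -> G) : (i <= k)%N -> (forall j, commutators G (s j)) ->
  commutator_products G k (\prod_(j < i) s j).
Proof.
move=> le_ik sP.
have /choice[c cP] : forall j : 'I_i, exists c : G * G, s j = [~ c.1, c.2].
  by move=> j; have [x [y ->]] := sP j; exists (x, y).
pose d (j : nat) := if insub j is Some j' then c j' else (1, 1).
exists d; rewrite (big_cat_nat _ le_ik) //= [X in _ * X]big_nat
  [X in _ * X]big1 ?mulg1.
  rewrite big_mkord; apply: eq_bigr => j _.
  by rewrite cP /d valK.
by move=> j /andP[le_ij _]; rewrite /d insubN -?leqNgt //= commg1.
Qed.

Definition derived_commutators (G : groupType) : set (derived_group G) :=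
  [set u | commutators G (val u)].
Arguments derived_commutators : clear implicits.

Section DerivedGroup.
Variable G : groupType.

Lemma mem_derived_commutator (x y : G) : [~ x, y] \in derived G.
Proof. by apply/mem_set => K [_]; apply; exists x, y. Qed.

Lemma commutator_products_derived k (x : G) :
  commutator_products G k x -> x \in derived G.
Proof.
case=> c ->; have [D1 DM] := generated_subgroup (commutators G).
elim/big_rec: _ => [|j y _ yD]; first exact: D1.
exact: (group_closedM (conj D1 DM)) (mem_derived_commutator _ _) yD.
Qed.

Lemma symmetric_derived_commutators : symmetric_set (derived_commutators G).
Proof.
have invP u : derived_commutators G u -> derived_commutators G u^-1.
  by case=> x [y uE]; exists y, x; rewrite -invgR -uE; exact: gmulfV.
apply/seteqP; split=> [u uP | _ [u uP <-]]; last exact: invP.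
by exists u^-1; [exact: invP | rewrite invgK].
Qed.

(** A subgroup of [G'] that contains the commutators has a subgroup of [G] as
    its image, and this image contains [G'] by minimality. *)
Lemma generated_derived_commutators :
  generated (derived_commutators G) = [set: derived_group G].
Proof.
apply/seteqP; split=> // u _ K [[K1 KD] SK].
have: (val @` K) (val u).
  have /set_mem uD := valP u; apply: uD; split.
    split; first by apply/mem_set; exists 1; [exact: set_mem K1 | exact: val1].
    move=> _ _ /set_mem[a Ka <-] /set_mem[b Kb <-]; apply/mem_set.
    exists (a / b); first exact: set_mem (KD _ _ (mem_set Ka) (mem_set Kb)).
    exact: gmulfF.
  move=> _ [x [y ->]].
  exists (Sub [~ x, y] (mem_derived_commutator x y)); last exact: SubK.
  by apply: SK; exists x, y; rewrite SubK.
by case=> v Kv /val_inj <-.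
Qed.

Lemma val_derived_prod I (r : seq I) (F : I -> derived_group G) :
  val (\prod_(i <- r) F i) = \prod_(i <- r) val (F i).
Proof. by apply: (big_morph val) => //; exact: gmulfM. Qed.

Lemma ball_derived_commutators k u :
  ball (derived_commutators G) k u -> commutator_products G k (val u).
Proof.
case=> i /= le_ik [s sP ->]; rewrite val_derived_prod.
exact: short_commutator_product.
Qed.

Lemma val_eval_word (g : nat -> derived_group G) w :
  val (eval_word g w) = eval_word (val \o g) w.
Proof.
by rewrite val_derived_prod; apply: eq_bigr => -[i []].
Qed.

End DerivedGroup.

(** A law of [G'] holds at products of commutators of [G], as they lie in [G'];
    conversely the gauge condition is applied to [G'] generated by the
    commutators, whose ball of radius [k] consists of such products. *)
Lemma defines_integral (V : groupType -> Prop) (W : set word) (k : nat) :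
  defines W V -> gauge_bound V W k ->
  defines (subst_word (commutators_word k) @` W) (integral V).
Proof.
move=> WV gauge G; split=> [VG _ [w Ww <-] | GW].
  apply/identity_of_expansion => g gP.
  pose h i : derived_group G := Sub (g i) (commutator_products_derived (gP i)).
  have -> : g = val \o h by [].
  by rewrite -val_eval_word (proj1 (WV _) VG w Ww h) // val1.
apply: (gauge _ _ (@symmetric_derived_commutators G)
  (@generated_derived_commutators G)) => w Ww g gP.
apply: val_inj; rewrite val_eval_word val1.
have /identity_of_expansion := GW _ (imageP _ Ww).
by apply=> i; apply: ball_derived_commutators.
Qed.

Theorem theorem6p3 (V : groupType -> Prop) :
  variety V -> finitely_based V -> finite_gauge V ->
  finitely_based (integral V).
Proof.
move=> _ _ [W [WV [k [gauge _]]]].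
exists [seq subst_word (commutators_word k) w | w <- W].
have := defines_integral WV gauge; congr defines.
apply/seteqP; split=> [_ [w Ww <-] | u /mapP[w Ww ->]]; first exact: map_f.
by exists w.
Qed.
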